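(* Let $\mathcal{H}$ be an $r$-uniform $r$-partite linear hypergraph ($r\ge 3$). If $\mathcal{H}$ is $\mathcal{G}_r(3r-3,3)$-free, then it is also $\mathcal{G}_r(5r-7,5)$-free.
   Context: A hypergraph is linear if any two distinct edges share at most one vertex. An $r$-uniform hypergraph is $r$-partite if its vertex set is partitioned into $r$ parts such that every edge contains exactly one vertex of each part. An $r$-uniform hypergraph is $\mathcal{G}_r(v,e)$-free if the union of any $e$ distinct edges has at least $v+1$ vertices. *)

(* Defs.v *)
From mathcomp Require Import all_boot.

Set Implicit Arguments.
Unset Strict Implicit.
Unset Printing Implicit Defensive.

(* A finite hypergraph is given by its vertex set, a finType V, and its set of
   edges E : {set {set V}}; in particular there are no repeated edges. *)

Definition uniform (V : finType) (r : nat) (E : {set {set V}}) : Prop :=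
  forall e : {set V}, e \in E -> #|e| = r.

Definition linear (V : finType) (E : {set {set V}}) : Prop :=
  forall e f : {set V}, e \in E -> f \in E -> e != f -> #|e :&: f| <= 1.

(* The parts are indexed by 'I_r and are not required to be nonempty; they are
   automatically nonempty as soon as there is an edge. *)
Definition partite (V : finType) (r : nat) (E : {set {set V}}) : Prop :=
  exists part : 'I_r -> {set V},
    [/\ \bigcup_(i < r) part i = [set: V],
        forall i j : 'I_r, i != j -> [disjoint part i & part j]
      & forall (e : {set V}) (i : 'I_r), e \in E -> #|e :&: part i| = 1].

(* G_r(v, e)-freeness; the uniformity r is that of the hypergraph E. *)
Definition Gfree (V : finType) (v e : nat) (E : {set {set V}}) : Prop :=
  forall F : {set {set V}}, F \subset E -> #|F| = e -> v + 1 <= #|cover F|.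

(* Main.v *)
Require Import Defs.
From mathcomp Require Import all_boot.
From mathcomp Require Import zify.

Set Implicit Arguments.
Unset Strict Implicit.
Unset Printing Implicit Defensive.

(** Three edges spanning at most 3r-3 vertices are excluded, so an edge meets
    the union of two other, intersecting edges in at most one vertex.  As in
    Mantel's theorem, removing two intersecting edges from n+2 edges then
    loses at most n+1 from the overlap n r - |union|; hence n edges overlap by
    at most n^2/4 vertices, which is 6 for n = 5. *)

Lemma coverD1 (V : finType) (F : {set {set V}}) (e : {set V}) :
  e \in F -> cover F = e :|: cover (F :\ e).
Proof. by move=> eF; rewrite /cover (big_setD1 e). Qed.

Lemma card_cover_capr (V : finType) (F : {set {set V}}) (A : {set V}) :
  #|cover F :&: A| <= \sum_(g in F) #|g :&: A|.
Proof.
rewrite /cover setIC big_distrr /=; under eq_bigr do rewrite setIC.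
apply: (big_ind2 (fun (B : {set V}) m => #|B| <= m)) => //.
  by rewrite cards0.
move=> B m C p leBm leCp; apply: leq_trans (leq_add leBm leCp).
by rewrite cardsU leq_subr.
Qed.

Section TriangleFree.

Variables (V : finType) (r : nat) (E : {set {set V}}).
Hypotheses (E_uniform : uniform r E) (E_linear : linear E).
Hypothesis E_free3 : Gfree (3 * r - 3) 3 E.

(** As [e] and [f] meet, r >= 1 and their union has at most 2r-1 vertices. The three edges together
    span at least 3r-2, so [g] shares at most r + (2r-1) - (3r-2) = 1 vertex with that union. *)
Lemma card_meet_intersecting (e f g : {set V}) :
    e \in E -> f \in E -> g \in E -> e != f -> g != e -> g != f ->
  ~~ [disjoint e & f] -> #|g :&: (e :|: f)| <= 1.
Proof.
move=> eE fE gE neq_ef neq_ge neq_gf; rewrite -setI_eq0 -card_gt0 => meet_ef.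
have subE : [set g; e; f] \subset E.
  by apply/subsetP=> x; rewrite !inE -orbA => /or3P[] /eqP->.
have card3 : #|[set g; e; f]| = 3.
  by rewrite -setUA cardsU1 cards2 !inE negb_or neq_ge neq_gf neq_ef.
have cover3 : cover [set g; e; f] = g :|: (e :|: f).
  by rewrite /cover -setUA big_setU1 ?big_setU1 ?big_set1 ?inE ?negb_or
    ?neq_ge ?neq_gf.
have := E_free3 subE card3; rewrite cover3.
have := cardsUI g (e :|: f); have := cardsUI e f.
have := E_uniform eE; have := E_uniform fE; have := E_uniform gE.
lia.
Qed.

(** Intersecting pairs play the role of adjacent vertices in a triangle-free graph. The additive
    form avoids truncated subtraction in the overlap. *)
Lemma card_cover_mantel (F : {set {set V}}) :
  F \subset E -> #|F| * r <= #|cover F| + #|F| ^ 2 %/ 4.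
Proof.
have [n] := ubnP #|F|; elim: n => // n IHn in F * => ltFn FE.
(* Base case: [trivIset F] is by definition the equality of the sum of the edge sizes with
   [#|cover F|], so the overlap is 0. *)
have [/eqP <-|] := boolP (trivIset F).
  rewrite (eq_bigr (fun=> r)) ?sum_nat_const ?leq_addr // => e eF.
  by rewrite E_uniform ?(subsetP FE).
have [|eq_ex ntF] := boolP [exists e in F, exists f in F,
    (e != f) && ~~ [disjoint e & f]]; last first.
  case/negP: ntF; apply/trivIsetP => e f eF fF neq_ef.
  apply: contraNT eq_ex => meet_ef; apply/exists_inP; exists e => //.
  by apply/exists_inP; exists f => //; rewrite neq_ef.
case/exists_inP=> e eF /exists_inP[f fF /andP[neq_ef meet_ef]] _.
have [eE fE] := (subsetP FE e eF, subsetP FE f fF).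
have fF1 : f \in F :\ e by rewrite !inE eq_sym neq_ef.
set F' := F :\ e :\ f.
have cardF : #|F| = #|F'|.+2 by rewrite (cardsD1 e) eF (cardsD1 f) fF1.
have F'E : F' \subset E.
  by apply: subset_trans FE; rewrite /F' !subDset setUA subsetUr.
have coverF : cover F = cover F' :|: (e :|: f).
  by rewrite (coverD1 eF) (coverD1 fF1) setUA setUC.
have overlap : #|cover F' :&: (e :|: f)| <= #|F'|.
  apply: leq_trans (card_cover_capr F' (e :|: f)) _.
  rewrite -[leqRHS]muln1 -sum_nat_const; apply: leq_sum => g gF'.
  have gE := subsetP F'E g gF'.
  move: gF'; rewrite !inE => /and3P[neq_gf neq_ge _].
  exact: card_meet_intersecting.
have := IHn F' ltac:(lia) F'E; rewrite coverF cardF.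
have := cardsUI (cover F') (e :|: f); have := cardsUI e f.
have := E_linear eE fE neq_ef.
have := E_uniform eE; have := E_uniform fE.
(* Exact despite the floor, since (m+2)^2 = m^2 + 4(m+1). The increment m+1 pays for [overlap] (at
   most m) and for [e :&: f] (at most 1, by linearity). *)
have -> : #|F'|.+2 ^ 2 %/ 4 = #|F'| ^ 2 %/ 4 + #|F'|.+1.
  by rewrite -divnDMl //; congr (_ %/ _); lia.
lia.
Qed.

End TriangleFree.

Theorem theorem13 (r : nat) (V : finType) (E : {set {set V}})
  (r_ge3 : 3 <= r) (E_uniform : uniform r E) (E_partite : partite r E)
  (E_linear : linear E) (E_free3 : Gfree (3 * r - 3) 3 E) :
  Gfree (5 * r - 7) 5 E.
Proof.
move=> F FE cardF.
have := card_cover_mantel E_uniform E_linear E_free3 FE.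
(* The union has at least 5r-6 = (5r-7)+1 vertices; [r_ge3] keeps 5r-7 from truncating. *)
rewrite cardF (_ : 5 ^ 2 %/ 4 = 6) //; lia.
Qed.
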